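(* Let $1<q\le 2$ and let $E$ be a real $q$-uniformly smooth and $2$-uniformly convex Banach space with normalized duality mapping $J:E\to E^*$. Let $C$ be a nonempty closed convex subset of $E$ and let $T:C\to E$ be a mapping of firmly nonexpansive type. Then for every $R>0$ there is a constant $L$ such that for all $x,y\in C$ with $\|x\|\le R$ and $\|y\|\le R$, $$\|Tx-Ty\|\le L\,\|x-y\|^{q-1}.$$
   Context: The normalized duality mapping of $E$ is $Jx=\{x^*\in E^*:\langle x,x^*\rangle=\|x\|^2=\|x^*\|^2\}$; when $E$ is smooth (in particular $q$-uniformly smooth), $Jx$ is a singleton for every $x$ and $J$ is regarded as a map $E\to E^*$. The modulus of smoothness of $E$ is $$\rho_E(\tau)=\sup\left\{\frac{\|x+\tau y\|+\|x-\tau y\|}{2}-1:\ \|x\|=\|y\|=1\right\},$$ and $E$ is $q$-uniformly smooth ($1<q\le 2$) if there is a constant $K>0$ with $\rho_E(\tau)\le K\tau^q$ for all $\tau>0$. The modulus of convexity of $E$ is $$\delta_E(\varepsilon)=\inf\left\{1-\frac{\|x+y\|}{2}:\ \|x\|=\|y\|=1,\ \|x-y\|=\varepsilon\right\},$$ and $E$ is $2$-uniformly convex if there is a constant $c>0$ with $\delta_E(\varepsilon)\ge c\,\varepsilon^2$ for all $\varepsilon\in(0,2]$. A mapping $T:C\to E$ is of firmly nonexpansive type if $$\langle Tx-Ty,\ JTx-JTy\rangle\le\langle Tx-Ty,\ Jx-Jy\rangle\quad\text{for all }x,y\in C,$$ where $\langle\cdot,\cdot\rangle$ is the pairing between $E$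 and $E^*$. *)

(* Defs.v *)
From HB Require Import structures.
From mathcomp Require Import all_boot all_order all_algebra.
From mathcomp Require Import all_classical all_reals all_analysis.

Set Implicit Arguments.
Unset Strict Implicit.
Unset Printing Implicit Defensive.

Import Order.TTheory GRing.Theory Num.Theory.
Import numFieldNormedType.Exports.

Local Open Scope classical_set_scope.
Local Open Scope ring_scope.

Section Dual.
Context {R : realType} (E : normedModType R).

(* The dual space E^*; its elements are applied to vectors as functions, so the
   pairing <x, f> is written f x. *)
Record dual_space := Dual {
  dual_fun :> {linear E -> R^o} ;
  dual_continuous : continuous dual_fun }.

HB.instance Definition _ := gen_eqMixin dual_space.
HB.instance Definition _ := gen_choiceMixin dual_space.

Lemma continuous_null_fun : continuous (\0 : {linear E -> R^o}).
Proof. by move=> x; exact: cvg_cst. Qed.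

Definition dual0 : dual_space := Dual continuous_null_fun.

(* A continuous functional is bounded on the (nonempty) closed unit ball, so
   this real supremum is the operator norm. *)
Definition dual_norm (f : dual_space) : R :=
  sup [set `|f x| | x in [set x : E | `|x| <= 1]].

Definition duality_set (x : E) : set dual_space :=
  [set f : dual_space | f x = `|x| ^+ 2 /\ `|x| ^+ 2 = dual_norm f ^+ 2].

(* When E is smooth, [duality_set x] is a singleton and [duality_map x] is its
   element; the default value [dual0] is irrelevant, as [duality_set x] is
   nonempty. *)
Definition duality_map (x : E) : dual_space := xget dual0 (duality_set x).

End Dual.

Section Geometry.
Context {R : realType} (E : normedModType R).

(* The moduli are extended reals because the sets below can be empty: if
   dim E = 1 then [convexity_modulus eps] has to be +oo, not 0, when
   0 < eps < 2. *)
Definition smoothness_modulus (tau : R) : \bar R :=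
  ereal_sup [set u | exists x y : E, [/\ `|x| = 1, `|y| = 1 &
    u = ((`|x + tau *: y| + `|x - tau *: y|) / 2 - 1)%:E]].

Definition q_uniformly_smooth (q : R) : Prop :=
  exists2 K : R, 0 < K &
    forall tau : R, 0 < tau -> (smoothness_modulus tau <= (K * tau `^ q)%:E)%E.

Definition convexity_modulus (eps : R) : \bar R :=
  ereal_inf [set u | exists x y : E, [/\ `|x| = 1, `|y| = 1, `|x - y| = eps &
    u = (1 - `|x + y| / 2)%:E]].

Definition two_uniformly_convex : Prop :=
  exists2 c : R, 0 < c &
    forall eps : R, 0 < eps -> eps <= 2 ->
      ((c * eps ^+ 2)%:E <= convexity_modulus eps)%E.

(* A mapping C -> E is represented by a total function whose values outside C
   are ignored. *)
Definition firmly_nonexpansive_type (C : set E) (T : E -> E) : Prop :=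
  forall x y : E, C x -> C y ->
    (duality_map (T x) \- duality_map (T y)) (T x - T y) <=
    (duality_map x \- duality_map y) (T x - T y).

End Geometry.

(* Main.v *)
(** 2-uniform convexity makes [J] strongly monotone, and [q]-uniform smoothness
    makes [J] Hoelder continuous with exponent [q - 1] on bounded sets; for [T]
    of firmly nonexpansive type this gives, with [h = Tx - Ty],
    [m |h|^2 <= <h, JTx - JTy> <= <h, Jx - Jy> <= M |x - y|^(q-1) |h|].
    Both properties of [J] reduce to unit vectors [u], [v] with norming
    functionals [f], [g]: convexity at [u + v] bounds [2 - f v - g u] from below
    by [4 c |u - v|^2], and smoothness at [u] compares [f (u + s h) + g (u - s h)]
    with [2].  That [Jx] is nonempty needs no Hahn-Banach theorem here: smoothness
    makes the one-sided directional derivative of the norm linear. *)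
Require Import Defs.
From HB Require Import structures.
From mathcomp Require Import all_boot all_order all_algebra.
From mathcomp Require Import all_classical all_reals all_analysis.
From mathcomp Require Import ring lra.

Set Implicit Arguments.
Unset Strict Implicit.
Unset Printing Implicit Defensive.

Import Order.TTheory GRing.Theory Num.Theory.
Import numFieldNormedType.Exports.

Local Open Scope classical_set_scope.
Local Open Scope ring_scope.

(** * Norming functionals of unit vectors under the two moduli *)

Definition smoothness_bound (R : realType) (E : normedModType R) (q K : R) : Prop :=
  forall tau : R, 0 < tau -> (smoothness_modulus E tau <= (K * tau `^ q)%:E)%E.

Definition convexity_bound (R : realType) (E : normedModType R) (c : R) : Prop :=
  forall eps : R, 0 < eps -> eps <= 2 ->
    ((c * eps ^+ 2)%:E <= convexity_modulus E eps)%E.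

(** For linear [f] the one-sided bound at [z] and [-z] gives the bound on the absolute value, so [f]
    has norm 1. *)
Definition unit_support (R : realType) (E : normedModType R)
    (u : E) (f : E -> R) : Prop :=
  [/\ `|u| = 1, f u = 1 & forall z, f z <= `|z|].

(** Both [f (u + v) = 1 + f v] and [g (u + v) = 1 + g u] are at most [|u + v|], which the modulus
    bounds by [2 - 2c|u - v|^2]; the two estimates are added. *)
Lemma unit_support_convexity (R : realType) (E : normedModType R) (c : R)
    (f g : {linear E -> R^o}) (u v : E) :
  convexity_bound E c ->
  unit_support u f -> unit_support v g ->
  4 * c * `|u - v| ^+ 2 <= 2 - f v - g u.
Proof.
move=> convE [u1 fu fle] [v1 gv gle].
have [uv0|uv_neq0] := eqVneq `|u - v| 0.
  have := fle v; have := gle u; rewrite uv0 u1 v1 => h1 h2.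
  by rewrite expr0n /= mulr0; lra.
have eps0 : 0 < `|u - v| by rewrite lt_def uv_neq0 normr_ge0.
have eps2 : `|u - v| <= 2 by have := ler_normB u v; rewrite u1 v1; lra.
have midpoint : c * `|u - v| ^+ 2 <= 1 - `|u + v| / 2.
  rewrite -lee_fin; apply: (le_trans (convE _ eps0 eps2)).
  by apply: ereal_inf_lbound; exists u, v.
have := fle (u + v); have := gle (u + v).
rewrite !linearD /= fu gv => h1 h2.
by move: midpoint h1 h2; set n := `|u + v|; set e := _ ^+ 2; lra.
Qed.

Lemma smooth_norm (R : realType) (E : normedModType R) (q K : R) (u h : E) :
  0 < q -> smoothness_bound E q K ->
  `|u| = 1 -> `|u + h| + `|u - h| <= 2 + 2 * K * `|h| `^ q.
Proof.
move=> q0 smE u1; have [->|h0] := eqVneq h 0.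
  by rewrite addr0 subr0 u1 normr0 powR0 ?gt_eqF// mulr0; lra.
have nh0 : 0 < `|h| by rewrite normr_gt0.
pose k := `|h|^-1 *: h.
have hk : h = `|h| *: k by rewrite scalerA divff ?gt_eqF// scale1r.
have k1 : `|k| = 1.
  by rewrite normrZ normfV normr_id mulVf ?gt_eqF.
have : (`|u + h| + `|u - h|) / 2 - 1 <= K * `|h| `^ q.
  rewrite -lee_fin; apply: le_trans (smE _ nh0).
  by apply: ereal_sup_ubound; exists u, k; rewrite -hk.
by lra.
Qed.

(** Smoothness at [u], tested on [f (u + s h) + g (u - s h)] with [s|h| = t], gives
    [s (f h - g h) <= 2K t^q + (1 - g u)]. A free radius [t] stays positive even when [u = v]. *)
Lemma unit_support_smoothness (R : realType) (E : normedModType R) (q K t : R)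
    (f g : {linear E -> R^o}) (u v h : E) :
  0 < q -> 0 < K -> smoothness_bound E q K ->
  unit_support u f -> unit_support v g ->
  0 < t -> `|u - v| <= t ->
  f h - g h <= 4 * K * t `^ (q - 1) * `|h|.
Proof.
move=> q0 K0 smE [u1 fu fle] [v1 gv gle] t0 uvt.
have [->|h0] := eqVneq h 0.
  by rewrite (linear0 f) (linear0 g) normr0 mulr0 subrr.
have nh0 : 0 < `|h| by rewrite normr_gt0.
(* Smoothness at [v] with increment [v - u]: the two norms are [|2v - u| >= 2 - g u] and
   [|u| = 1]. *)
have gu : 1 - g u <= 2 * K * t `^ q.
  have := smooth_norm (v - u) q0 smE v1.
  rewrite subKr u1 distrC => A.
  have := gle (v + (v - u)); rewrite !linearD linearN /= gv => B.
  have : `|u - v| `^ q <= t `^ q by rewrite ge0_ler_powR ?nnegrE ?(ltW t0) ?(ltW q0).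
  rewrite -(ler_pM2l K0).
  by move: A B; set X := `|v + _|; set P := _ `^ q; set Q := t `^ q; lra.
pose s := t / `|h|.
have s0 : 0 < s by rewrite divr_gt0.
have := smooth_norm (s *: h) q0 smE u1.
rewrite normrZ gtr0_norm// divfK ?gt_eqF// => A.
have := fle (u + s *: h); have := gle (u - s *: h).
have -> : g (u - s *: h) = g u - s * g h by rewrite linearB linearZ.
have -> : f (u + s *: h) = 1 + s * f h by rewrite linearD linearZ fu.
move=> C B.
have key : s * (f h - g h) <= 4 * K * t `^ q.
  rewrite mulrBr; move: A B C gu.
  set X := `|_ + _|; set Y := `|_ - _|; set Q := t `^ q.
  set F := s * f h; set G := s * g h; set U := g u.
  move=> A B C D. lra.
rewrite -(ler_pM2l s0) (le_trans key)// -(mulr_powRB1 (ltW t0) q0).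
rewrite le_eqVlt; apply/orP; left; apply/eqP; rewrite /s.
by field; rewrite gt_eqF.
Qed.

(** * One-sided derivative of the norm and existence of norming functionals *)

Definition norm_quotient (R : realType) (E : normedModType R)
    (u h : E) (t : R) : R := (`|u + t *: h| - `|u|) / t.

(* By convexity this infimum is the one-sided derivative of the norm at [u] in
   the direction [h]. *)
Definition norm_derivative (R : realType) (E : normedModType R) (u h : E) : R :=
  inf [set norm_quotient u h t | t in [set t : R | 0 < t]].

(** Bounds the set in [norm_derivative] from below, so that its [inf] is a true infimum. *)
Lemma norm_quotient_ge (R : realType) (E : normedModType R) (u h : E) (t : R) :
  0 < t -> - `|h| <= norm_quotient u h t.
Proof.
move=> t0; rewrite /norm_quotient ler_pdivlMr//.
have := ler_normB (u + t *: h) (t *: h).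
by rewrite addrK normrZ (gtr0_norm t0); lra.
Qed.

Lemma norm_derivative_le (R : realType) (E : normedModType R) (u h : E) (t : R) :
  0 < t -> norm_derivative u h <= norm_quotient u h t.
Proof.
move=> t0; apply: ge_inf; last by exists t.
by exists (- `|h|) => _ [s s0 <-]; exact: norm_quotient_ge.
Qed.

Lemma le_norm_derivative (R : realType) (E : normedModType R) (u h : E) (m : R) :
  (forall t, 0 < t -> m <= norm_quotient u h t) -> m <= norm_derivative u h.
Proof.
move=> mle; apply: lb_le_inf; last by move=> _ [s s0 <-]; exact: mle.
by exists (norm_quotient u h 1); exists 1 => //=.
Qed.

Lemma norm_derivative_le_norm (R : realType) (E : normedModType R) (u h : E) :
  norm_derivative u h <= `|h|.
Proof.
apply: (le_trans (norm_derivative_le u h ltr01)).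
by rewrite /norm_quotient divr1 scale1r; have := ler_normD u h; lra.
Qed.

Lemma norm_derivative0 (R : realType) (E : normedModType R) (u : E) :
  norm_derivative u 0 = 0.
Proof.
have q0 t : norm_quotient u 0 t = 0.
  by rewrite /norm_quotient scaler0 addr0 subrr mul0r.
apply/eqP; rewrite eq_le -{1}(q0 1) norm_derivative_le//=.
by apply: le_norm_derivative => t _; rewrite q0.
Qed.

Lemma norm_derivative_self (R : realType) (E : normedModType R) (u : E) :
  norm_derivative u u = `|u|.
Proof.
apply/eqP; rewrite eq_le norm_derivative_le_norm/=.
apply: le_norm_derivative => t t0.
rewrite /norm_quotient -[X in `|X + _|]scale1r -scalerDl normrZ.
by rewrite gtr0_norm ?addr_gt0// ler_pdivlMr//; lra.
Qed.

Lemma norm_derivativeZ_le (R : realType) (E : normedModType R) (a : R)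
    (u h : E) :
  0 < a -> norm_derivative u (a *: h) <= a * norm_derivative u h.
Proof.
move=> a0; rewrite mulrC -ler_pdivrMr//; apply: le_norm_derivative => t t0.
rewrite ler_pdivrMr//.
apply: (le_trans (norm_derivative_le u (a *: h) (divr_gt0 t0 a0))).
rewrite /norm_quotient scalerA divfK ?gt_eqF//.
by rewrite le_eqVlt; apply/orP; left; apply/eqP; field; rewrite !gt_eqF.
Qed.

Lemma norm_derivativeZ (R : realType) (E : normedModType R) (a : R) (u h : E) :
  0 < a -> norm_derivative u (a *: h) = a * norm_derivative u h.
Proof.
move=> a0; apply/eqP; rewrite eq_le norm_derivativeZ_le//=.
have ai0 : 0 < a^-1 by rewrite invr_gt0.
have := norm_derivativeZ_le u (a *: h) ai0.
rewrite scalerA mulVf ?gt_eqF// scale1r -(ler_pM2l a0).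
by rewrite mulrA divff ?gt_eqF// mul1r.
Qed.

(** Convexity of the norm: [t (u + s h)] is the sum of [(t - s) u] and [s (u + t h)]. *)
Lemma norm_quotient_homo (R : realType) (E : normedModType R) (u h : E)
    (s t : R) :
  0 < s -> s <= t -> norm_quotient u h s <= norm_quotient u h t.
Proof.
move=> s0 st; have t0 := lt_le_trans s0 st.
have := ler_normD ((t - s) *: u) (s *: (u + t *: h)).
have -> : (t - s) *: u + s *: (u + t *: h) = t *: (u + s *: h).
  by rewrite scalerBl !scalerDr !scalerA (mulrC s t) addrA subrK.
rewrite !normrZ (gtr0_norm s0) (gtr0_norm t0) ger0_norm ?subr_ge0// => le_norm.
rewrite /norm_quotient ler_pdivrMr// mulrAC ler_pdivlMr//.
by move: le_norm; set X := `|u|; set Y := `|_ + _|; set Z := `|_ + _|; nra.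
Qed.

(** The midpoint of [u + t h] and [u + t k] is [u + (t/2)(h + k)], whence the halved step. *)
Lemma norm_quotientD (R : realType) (E : normedModType R) (u h k : E) (t : R) :
  0 < t ->
  norm_quotient u (h + k) (t / 2) <= norm_quotient u h t + norm_quotient u k t.
Proof.
move=> t0; have := ler_normD (u + t *: h) (u + t *: k).
have -> : u + t *: h + (u + t *: k) = 2 *: (u + (t / 2) *: (h + k)).
  rewrite scalerDr scalerA mulrC divfK ?pnatr_eq0// scalerDr.
  by rewrite addrACA -[u in X in X + _ = _]scale1r -scalerDl.
rewrite normrZ ger0_norm// /norm_quotient -mulrDl => le_norm.
by rewrite ler_pdivlMr// -mulrA invf_div divfK ?gt_eqF//; lra.
Qed.

Lemma norm_derivativeD (R : realType) (E : normedModType R) (u h k : E) :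
  norm_derivative u (h + k) <= norm_derivative u h + norm_derivative u k.
Proof.
rewrite -lerBlDr; apply: le_norm_derivative => s s0.
rewrite lerBlDr -lerBlDl; apply: le_norm_derivative => t t0; rewrite lerBlDl.
(* The two infima have independent steps [s] and [t]; monotonicity of the quotients allows replacing
   both by the smaller one. *)
have m0 : 0 < Num.min s t by rewrite lt_min s0.
have m20 : 0 < Num.min s t / 2 by rewrite divr_gt0.
apply: (le_trans (norm_derivative_le u (h + k) m20)).
apply: (le_trans (norm_quotientD u h k m0)).
by rewrite lerD// norm_quotient_homo// ge_min lexx ?orbT.
Qed.

(** Here smoothness enters: the quotients along [h] and [-h] sum to at most [2K|h|^q t^(q-1)], which
    tends to 0 with [t] because [q > 1]. *)
Lemma norm_derivativeN (R : realType) (E : normedModType R) (q K : R) (u h : E) :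
  1 < q -> 0 < K -> smoothness_bound E q K ->
  `|u| = 1 -> norm_derivative u (- h) = - norm_derivative u h.
Proof.
move=> q1 K0 smE u1; have q0 : 0 < q := lt_trans ltr01 q1.
have q10 : 0 < q - 1 by rewrite subr_gt0.
apply/eqP; rewrite -addr_eq0 eq_le; apply/andP; split; last first.
  by rewrite -(norm_derivative0 u) -(addNr h) norm_derivativeD.
apply/ler_addgt0Pr => e e0; rewrite add0r.
(* The summand 1 keeps [M] positive when [h = 0]; [t] is then chosen so that [t^(q-1) = e / M]. *)
pose M := 2 * K * `|h| `^ q + 1.
have M0 : 0 < M.
  by rewrite ltr_wpDl// mulr_ge0 ?powR_ge0// mulr_ge0 ?(ltW K0).
pose t := (e / M) `^ (q - 1)^-1.
have t0 : 0 < t by apply: powR_gt0; exact: divr_gt0.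
have tq : t `^ (q - 1) = e / M.
  by rewrite -powRrM mulVf ?gt_eqF// powRr1// divr_ge0 ?ltW.
apply: (le_trans (lerD (norm_derivative_le u _ t0) (norm_derivative_le u _ t0))).
rewrite /norm_quotient -mulrDl ler_pdivrMr// u1 scalerN.
have := smooth_norm (t *: h) q0 smE u1.
rewrite normrZ (gtr0_norm t0) powRM ?(ltW t0)// -(mulr_powRB1 (ltW t0) q0) tq.
set X := `|_ + _|; set Y := `|_ - _|; set P := `|h| `^ q => le_norm.
have : 2 * K * P * (e / M) <= e.
  by rewrite mulrCA ger_pMr// ler_pdivrMr// mul1r /M -/P lerDl.
rewrite -(ler_pM2l t0) => le_e.
by move: le_norm le_e; set m := e / M; lra.
Qed.

(** The derivative of the norm at [u] is sublinear, and by smoothness odd, hence linear. *)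
Lemma exists_unit_support (R : realType) (E : normedModType R) (q K : R) (u : E) :
  1 < q -> 0 < K -> smoothness_bound E q K ->
  `|u| = 1 -> exists f : {linear E -> R^o}, unit_support u f.
Proof.
move=> q1 K0 smE u1; pose p : E -> R^o := norm_derivative u.
have pN h : p (- h) = - p h := norm_derivativeN h q1 K0 smE u1.
have pD h k : p (h + k) = p h + p k.
  apply/eqP; rewrite eq_le [X in X && _]norm_derivativeD/=.
  rewrite -lerN2 opprD -!pN opprD; exact: norm_derivativeD.
have pZ a h : p (a *: h) = a * p h.
  have [a0|a0|<-] := ltgtP 0 a.
  - exact: norm_derivativeZ.
  - rewrite -[a]opprK scaleNr pN mulNr; congr (- _).
    by apply: norm_derivativeZ; rewrite oppr_gt0.
  - by rewrite scale0r mul0r; exact: norm_derivative0.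
have p_linear : linear p by move=> a h k; rewrite pD pZ.
pose pM := GRing.isLinear.Build R E R^o *:%R p p_linear.
pose f : {linear E -> R^o} := HB.pack p pM.
exists f; split => //; last exact: norm_derivative_le_norm.
by rewrite -u1; exact: norm_derivative_self.
Qed.

(** * Dual norm and values of the normalized duality mapping *)

Section DualNorm.
Context {R : realType} {E : normedModType R}.

Lemma has_sup_dual_norm (f : dual_space E) :
  has_sup [set `|f x| | x in [set x : E | `|x| <= 1]].
Proof.
split; first by exists `|f 0|; exists 0 => //=; rewrite normr0.
have /linear_boundedP : bounded_near f (nbhs (0 : E)).
  by apply/linear_bounded_continuous; exact: dual_continuous.
move=> /pinfty_ex_gt0[M M0 fM]; exists M => _ [x /= x1 <-].
by rewrite (le_trans (fM x))// ger_pMr.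
Qed.

Lemma dual_norm_ge0 (f : dual_space E) : 0 <= dual_norm f.
Proof.
rewrite (@le_trans _ _ `|f 0|)//; apply: sup_upper_bound.
  exact: has_sup_dual_norm.
by exists 0 => //=; rewrite normr0.
Qed.

Lemma dual_norm_le (f : dual_space E) (x : E) : `|f x| <= dual_norm f * `|x|.
Proof.
have [->|x0] := eqVneq x 0; first by rewrite linear0 !normr0 mulr0.
have nx0 : 0 < `|x| by rewrite normr_gt0.
rewrite -ler_pdivrMr//; apply: sup_upper_bound; first exact: has_sup_dual_norm.
exists (`|x|^-1 *: x) => /=.
  by rewrite normrZ normfV normr_id mulVf ?gt_eqF.
by rewrite linearZ/= normrM normfV normr_id mulrC.
Qed.

Lemma dual_norm_eq (f : dual_space E) (x : E) (a : R) :
  `|x| = 1 -> `|f x| = a -> (forall z, `|f z| <= a * `|z|) -> dual_norm f = a.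
Proof.
move=> x1 fx fle; apply/eqP; rewrite eq_le; apply/andP; split; last first.
  by rewrite -fx (le_trans (dual_norm_le f x))// x1 mulr1.
apply: sup_le_ub; first by case: (has_sup_dual_norm f).
move=> _ [z /= z1 <-]; rewrite (le_trans (fle z))// ler_piMr//.
by rewrite -fx.
Qed.

End DualNorm.

(** For nonzero [x], a member is [|x| f] with [f] norming [x / |x|]; for [x = 0] it is the zero
    functional. *)
Lemma duality_set_neq0 (R : realType) (E : normedModType R) (q K : R) (x : E) :
  1 < q -> 0 < K -> smoothness_bound E q K ->
  duality_set x !=set0.
Proof.
move=> q1 K0 smE; have [->|x0] := eqVneq x 0.
  exists (dual0 E); split; first by rewrite /= normr0 expr0n.
  have := dual_norm_ge0 (dual0 E); rewrite le_eqVlt => /orP[/eqP <-|].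
    by rewrite normr0.
  rewrite /dual_norm; have -> : [set `|dual0 E x| | x in [set x : E | `|x| <= 1]]
      = [set 0 : R].
    apply/seteqP; split => [_ [z _ <-]|_ ->] /=; first by rewrite normr0.
    by exists 0; rewrite /= normr0.
  by rewrite sup1 ltxx.
have nx0 : 0 < `|x| by rewrite normr_gt0.
pose u := `|x|^-1 *: x.
have u1 : `|u| = 1 by rewrite normrZ normfV normr_id mulVf ?gt_eqF.
have xu : x = `|x| *: u by rewrite scalerA divff ?gt_eqF// scale1r.
have [f [_ fu fle]] := exists_unit_support q1 K0 smE u1.
have absf z : `|f z| <= `|z|.
  by rewrite ler_norml fle andbT lerNl -linearN -normrN fle.
pose g : {linear E -> R^o} := `|x| \*: f.
have absg z : `|g z| <= `|x| * `|z|.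
  by rewrite /= normrM normr_id ler_pM2l.
have cg : continuous g.
  apply/linear_bounded_continuous/linear_boundedP.
  exists `|x|; split=> [|M xM z]; first exact: num_real.
  by rewrite (le_trans (absg z))// ler_wpM2r// ltW.
exists (Dual cg); split.
  by rewrite /= {2}xu linearZ fu /= /GRing.scale/= mulr1 expr2.
congr (_ ^+ 2); symmetry; apply: (@dual_norm_eq _ _ _ u) => //.
by rewrite /= fu /GRing.scale/= mulr1 normr_id.
Qed.

Lemma duality_mapP (R : realType) (E : normedModType R) (q K : R) (x : E) :
  1 < q -> 0 < K -> smoothness_bound E q K ->
  duality_map x x = `|x| ^+ 2 /\ forall z, `|duality_map x z| <= `|x| * `|z|.
Proof.
move=> q1 K0 smE; have [f xf] := duality_set_neq0 x q1 K0 smE.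
have [-> nJ] : duality_set x (duality_map x) by apply: (xgetPex (dual0 E)); exists f.
split => // z.
have -> : `|x| = dual_norm (duality_map x).
  (* Membership equates only the squares; both norms are nonnegative. *)
  by apply/eqP; rewrite -(@eqrXn2 _ 2) ?dual_norm_ge0// nJ.
exact: dual_norm_le.
Qed.

Lemma duality_map_unit_support (R : realType) (E : normedModType R) (q K : R)
    (x : E) :
  1 < q -> 0 < K -> smoothness_bound E q K ->
  x != 0 ->
  exists u : E, exists f : {linear E -> R^o},
    [/\ unit_support u f, x = `|x| *: u &
        forall z, duality_map x z = `|x| * f z].
Proof.
move=> q1 K0 smE x0; have nx0 : 0 < `|x| by rewrite normr_gt0.
have [Jx Jle] := duality_mapP x q1 K0 smE.
pose f : {linear E -> R^o} := `|x|^-1 \*: duality_map x.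
have fE z : f z = `|x|^-1 * duality_map x z by [].
exists (`|x|^-1 *: x), f; split.
- split.
  + by rewrite normrZ normfV normr_id mulVf ?gt_eqF.
  + by rewrite fE linearZ/= Jx /GRing.scale/=; field; rewrite gt_eqF.
  + move=> z; rewrite fE mulrC ler_pdivrMr// mulrC.
    by rewrite (le_trans _ (Jle z))// ler_norm.
- by rewrite scalerA divff ?gt_eqF// scale1r.
- by move=> z; rewrite fE mulrA divff ?gt_eqF// mul1r.
Qed.

(** * Strong monotonicity of the duality mapping *)

(** With [a = |x|], [b = |y|] the right side equals [(a - b)^2 + ab (2 - f v - g u)], while
    [|x - y|^2 <= 2(a - b)^2 + 2ab|u - v|^2]. Comparing the two terms separately requires [m <= 1/2]
    and [m <= 2c]. *)
Lemma duality_map_strongly_monotone (R : realType) (E : normedModType R)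
    (q K c : R) (x y : E) :
  1 < q -> 0 < K -> smoothness_bound E q K ->
  0 < c ->
  convexity_bound E c ->
  Num.min (1 / 2) (2 * c) * `|x - y| ^+ 2 <=
    duality_map x (x - y) - duality_map y (x - y).
Proof.
move=> q1 K0 smE c0 convE.
set m := Num.min _ _.
have m0 : 0 < m by rewrite lt_min !mulr_gt0.
have m_half : m <= 1 / 2 by rewrite ge_min lexx.
have m_c : m <= 2 * c by rewrite ge_min lexx orbT.
have [xJ xJle] := duality_mapP x q1 K0 smE.
have [yJ yJle] := duality_mapP y q1 K0 smE.
rewrite !linearB/= xJ yJ.
have [x0|x0] := eqVneq x 0.
  have := xJle y; rewrite x0 normr0 mul0r normr_le0 => /eqP ->.
  rewrite sub0r normrN linear0.
  by have := sqr_ge0 `|y|; set P := _ ^+ 2; nra.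
have [y0|y0] := eqVneq y 0.
  have := yJle x; rewrite y0 normr0 mul0r normr_le0 => /eqP ->.
  rewrite subr0 linear0.
  by have := sqr_ge0 `|x|; set P := _ ^+ 2; nra.
have nx0 : 0 < `|x| by rewrite normr_gt0.
have ny0 : 0 < `|y| by rewrite normr_gt0.
have [u [f [uf xu fE]]] := duality_map_unit_support q1 K0 smE x0.
have [v [g [vg yv gE]]] := duality_map_unit_support q1 K0 smE y0.
have := unit_support_convexity convE uf vg.
have [u1 _ _] := uf; have [v1 _ _] := vg.
have -> : duality_map x y = `|x| * (`|y| * f v).
  by rewrite fE {1}yv linearZ.
have -> : duality_map y x = `|y| * (`|x| * g u).
  by rewrite gE {1}xu linearZ.
(* [x - y] splits into a radial part and a part along the smaller of the two spheres, so the factor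
   is the minimum, whose square is at most [|x||y|]. *)
have dle : `|x - y| <= `|(`|x| - `|y|)| + Num.min `|x| `|y| * `|u - v|.
  have [xy|yx] := leP `|x| `|y|.
    have -> : x - y = (`|x| - `|y|) *: v + `|x| *: (u - v).
      by rewrite scalerBl scalerBr -xu -yv [RHS]addrC addrA subrK.
    by rewrite (le_trans (ler_normD _ _))// !normrZ v1 mulr1 normr_id.
  have -> : x - y = (`|x| - `|y|) *: u + `|y| *: (u - v).
    by rewrite scalerBl scalerBr -xu -yv addrA subrK.
  by rewrite (le_trans (ler_normD _ _))// !normrZ u1 mulr1 normr_id.
have min0 : 0 <= Num.min `|x| `|y| by rewrite le_min !normr_ge0.
have minM : Num.min `|x| `|y| ^+ 2 <= `|x| * `|y|.
  by rewrite expr2 ler_pM// ge_min lexx ?orbT.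
have sq_dle : `|x - y| ^+ 2 <=
    2 * (`|x| - `|y|) ^+ 2 + 2 * (`|x| * `|y|) * `|u - v| ^+ 2.
  have : `|x - y| ^+ 2 <= (`|(`|x| - `|y|)| + Num.min `|x| `|y| * `|u - v|) ^+ 2.
    by rewrite lerXn2r// nnegrE// addr_ge0// mulr_ge0.
  have := ler_wpM2r (sqr_ge0 `|u - v|) minM.
  have := real_normK (num_real (`|x| - `|y|)).
  set A := `|(_ - _)|; set N := Num.min _ _; set e := `|u - v|.
  have := sqr_ge0 (A - N * e).
  by set D := `|x - y|; nra.
move: sq_dle; set a := `|x|; set b := `|y|; set F := f v; set G := g u.
set P := `|u - v| ^+ 2; set D := `|x - y| ^+ 2 => sq_dle conv.
have P0 : 0 <= P by exact: sqr_ge0.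
have ab0 : 0 < a * b by rewrite mulr_gt0.
have S0 : 0 <= (a - b) ^+ 2 by exact: sqr_ge0.
have h1 : m * D <= m * (2 * (a - b) ^+ 2 + 2 * (a * b) * P) by rewrite ler_pM2l.
have h2 : m * (a - b) ^+ 2 <= 1 / 2 * (a - b) ^+ 2 by rewrite ler_wpM2r.
have h3 : m * (a * b * P) <= 2 * c * (a * b * P).
  by rewrite ler_wpM2r// mulr_ge0// ltW.
have h4 : a * b * (4 * c * P) <= a * b * (2 - F - G) by rewrite ler_pM2l.
by lra.
Qed.

(** * Hoelder continuity of the duality mapping on balls *)

(** The difference is [|x|(f h - g h) + (|x| - |y|) g h]: an angular term, controlled by smoothness,
    and a radial term of size at most [|x - y||h|]. *)
Lemma duality_map_hoelder (R : realType) (E : normedModType R) (q K r : R) :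
  1 < q -> q <= 2 -> 0 < K -> smoothness_bound E q K ->
  exists M : R, forall x y h : E, `|x| <= r -> `|y| <= r ->
    duality_map x h - duality_map y h <= M * `|x - y| `^ (q - 1) * `|h|.
Proof.
move=> q1 q2 K0 smE; have q0 : 0 < q := lt_trans ltr01 q1.
have q20 : 0 <= 2 - q by rewrite subr_ge0.
have q10 : 0 < q - 1 by rewrite subr_gt0.
have split_powR (t : R) : 0 <= t -> t = t `^ (2 - q) * t `^ (q - 1).
  move=> t0; rewrite -powRD; last first.
    by apply/implyP => /eqP e0; exfalso; lra.
  by rewrite addrA subrK [2 - 1]addrK powRr1.
(* The first summand serves the angular term. The second serves the radial term and the cases
   [x = 0] and [y = 0], through [d <= (2r)^(2-q) d^(q-1)] for [d <= 2r]. *)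
exists (4 * K * (r `^ (2 - q) * 2 `^ (q - 1)) + (2 * r) `^ (2 - q)).
move=> x y h xr yr; have r0 : 0 <= r by rewrite (le_trans _ xr).
set d := `|x - y|.
have d0 : 0 <= d by exact: normr_ge0.
have d_small : d <= (2 * r) `^ (2 - q) * d `^ (q - 1).
  rewrite {1}(split_powR d d0) ler_wpM2r ?powR_ge0//.
  rewrite ge0_ler_powR ?nnegrE ?mulr_ge0//.
  by rewrite (le_trans (ler_normB _ _))//; lra.
have coef0 : 0 <= 4 * K * (r `^ (2 - q) * 2 `^ (q - 1)) * d `^ (q - 1) * `|h|.
  by rewrite !mulr_ge0 ?powR_ge0// ltW.
rewrite 2!mulrDl.
have d_smallh := ler_wpM2r (normr_ge0 h) d_small.
have [_ xJle] := duality_mapP x q1 K0 smE.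
have [_ yJle] := duality_mapP y q1 K0 smE.
have [x0|x0] := eqVneq x 0.
  have := xJle h; rewrite x0 normr0 mul0r normr_le0 => /eqP ->.
  have yd : `|y| = d by rewrite /d x0 sub0r normrN.
  have := yJle h; rewrite yd ler_norml => /andP[Jy _].
  by move: coef0 d_smallh Jy; lra.
have [y0|y0] := eqVneq y 0.
  have := yJle h; rewrite y0 normr0 mul0r normr_le0 => /eqP ->.
  have xd : `|x| = d by rewrite /d y0 subr0.
  have := xJle h; rewrite xd ler_norml => /andP[_ Jx].
  by move: coef0 d_smallh Jx; lra.
(* Split off because the radius [2d / |x|] used below must be positive. *)
have [xy|xy] := eqVneq x y.
  by rewrite xy subrr addr_ge0// mulr_ge0// mulr_ge0// powR_ge0.
have d_gt0 : 0 < d by rewrite normr_gt0 subr_eq0.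
have nx0 : 0 < `|x| by rewrite normr_gt0.
have [u [f [uf xu fE]]] := duality_map_unit_support q1 K0 smE x0.
have [v [g [vg yv gE]]] := duality_map_unit_support q1 K0 smE y0.
have [v1 _ gle] := vg.
have dxy : `|(`|x| - `|y|)| <= d by exact: ler_dist_dist.
have uv_le : `|u - v| <= 2 * d / `|x|.
  rewrite ler_pdivlMr// mulrC -[X in X * _]normr_id -normrZ.
  have -> : `|x| *: (u - v) = (x - y) + (`|y| - `|x|) *: v.
    by rewrite scalerBr scalerBl -xu -yv addrA subrK.
  rewrite (le_trans (ler_normD _ _))// normrZ v1 mulr1 mulr_natl mulr2n.
  by rewrite lerD// distrC.
have t0 : 0 < 2 * d / `|x| by rewrite divr_gt0// mulr_gt0.
have := unit_support_smoothness h q0 K0 smE uf vg t0 uv_le.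
rewrite -(ler_pM2l nx0) => main.
(* The factor [|x|] absorbs the singularity of [2d / |x|] at the origin: the product is
   [|x|^(2-q) (2d)^(q-1)], and [q <= 2] makes the first power at most [r^(2-q)]. *)
have x_powR : `|x| * (2 * d / `|x|) `^ (q - 1) <=
    r `^ (2 - q) * 2 `^ (q - 1) * d `^ (q - 1).
  have -> : `|x| * (2 * d / `|x|) `^ (q - 1) =
      `|x| `^ (2 - q) * (2 * d) `^ (q - 1).
    rewrite -[X in _ = _ * X `^ _](divfK (lt0r_neq0 nx0)).
    rewrite [in RHS]powRM ?(ltW t0)// [in RHS]mulrCA -split_powR//.
    by rewrite mulrC.
  rewrite powRM// -mulrA.
  by rewrite ler_wpM2r ?mulr_ge0 ?powR_ge0// ge0_ler_powR ?nnegrE.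
have h0 := normr_ge0 h.
have gh : (`|x| - `|y|) * g h <= d * `|h|.
  rewrite (le_trans (ler_norm _))// normrM ler_pM//.
  by rewrite ler_norml gle andbT lerNl -linearN -normrN gle.
rewrite fE gE.
have : 4 * K * `|h| * (`|x| * (2 * d / `|x|) `^ (q - 1)) <=
    4 * K * `|h| * (r `^ (2 - q) * 2 `^ (q - 1) * d `^ (q - 1)).
  by rewrite ler_wpM2l// !mulr_ge0// ltW.
move: main gh d_smallh; set T := (2 * d / _) `^ _; set D := d `^ _.
set A := r `^ _ * _; set B := (2 * r) `^ _; set H := `|h|; set F := f h.
set G := g h; set a := `|x|; set b := `|y| => main gh dh fin.
by move: main gh dh fin; rewrite !mulrBr !mulrBl; lra.
Qed.

(** * Hoelder estimate for mappings of firmly nonexpansive type *)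

Theorem theorem3p3 (R : realType) (q : R) (E : completeNormedModType R)
    (C : set E) (T : E -> E) :
  1 < q -> q <= 2 ->
  q_uniformly_smooth E q ->
  two_uniformly_convex E ->
  C !=set0 -> closed C -> convex_set C ->
  firmly_nonexpansive_type C T ->
  forall r : R, 0 < r ->
    exists L : R, forall x y : E, C x -> C y -> `|x| <= r -> `|y| <= r ->
      `|T x - T y| <= L * `|x - y| `^ (q - 1).
Proof.
move=> q1 q2 [K K0 smE] [c c0 convE] _ _ _ fneT r _.
have [M JM] := duality_map_hoelder r q1 q2 K0 smE.
pose m := Num.min (1 / 2) (2 * c).
have m0 : 0 < m by rewrite lt_min !mulr_gt0.
(* The sign of [M] is unknown; the absolute value makes the bound nonnegative, which settles the
   case [T x = T y]. *)
exists (`|M| / m) => x y Cx Cy xr yr.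
have [->|Txy] := eqVneq (T x - T y) 0.
  by rewrite normr0 mulr_ge0 ?powR_ge0// divr_ge0// ltW.
have nT0 : 0 < `|T x - T y| by rewrite normr_gt0.
(* Strong monotonicity is global, so it applies at [T x] and [T y] whatever their norms; the Hoelder
   bound is taken at [x] and [y], inside the ball. One factor [|T x - T y|] then cancels. *)
have := duality_map_strongly_monotone (T x) (T y) q1 K0 smE c0 convE.
move=> /le_trans /(_ (fneT x y Cx Cy)) /le_trans /(_ (JM x y _ xr yr)).
rewrite -/m expr2 mulrA ler_pM2r// => le_m.
rewrite mulrAC ler_pdivlMr// mulrC (le_trans le_m)//.
by rewrite ler_wpM2r ?powR_ge0// ler_norm.
Qed.
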